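(* Let $t\ge 5$ be an integer and let $d=t-3$. Every $P_t$-free graph $G$ satisfies $\chi(G)\le \kappa_d\, d^{\,\omega(G)-1}$, where \[ \kappa_d=2d^5+2d^4-3d^3-d^2+2d+4+\frac{6d^2-6d+4}{(d-1)^3}\le 3d^5 . \] In particular, $\chi(G)\le 3(t-3)^{\omega(G)+4}$.
   Context: All graphs are finite and simple. $P_t$ is the path on $t$ vertices; a graph is $P_t$-free if it has no induced subgraph isomorphic to $P_t$. $\chi(G)$ is the chromatic number and $\omega(G)$ is the clique number (maximum number of pairwise adjacent vertices) of $G$. The inequality $\kappa_d\le 3d^5$ is part of the assertion. *)

(* Defs.v *)
From HB Require Import structures.
From mathcomp Require Import all_boot all_order all_algebra.

Set Implicit Arguments.
Unset Strict Implicit.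
Unset Printing Implicit Defensive.

Import Order.TTheory GRing.Theory Num.Theory.

Record sgraph := SGraph {
  vertex :> finType;
  edge : rel vertex;
  edge_sym : symmetric edge;
  edge_irrefl : irreflexive edge }.

Section Graph.
Variable G : sgraph.

Definition proper_coloring k (f : {ffun G -> 'I_k}) :=
  [forall x, forall y, edge x y ==> (f x != f y)].

Definition colorable k := [exists f : {ffun G -> 'I_k}, proper_coloring f].

Lemma ex_colorable : exists k, colorable k.
Proof.
exists #|G|; apply/existsP; exists [ffun x => enum_rank x].
apply/forallP => x; apply/forallP => y; apply/implyP => exy.
rewrite !ffunE; apply/eqP => /enum_rank_inj xy.
by rewrite xy edge_irrefl in exy.
Qed.

Definition chromatic_number : nat := ex_minn ex_colorable.

Definition clique (A : {set G}) :=
  [forall x in A, forall y in A, (x != y) ==> edge x y].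

Definition clique_number : nat := \max_(A : {set G} | clique A) #|A|.

Section Induced.
Variable A : {set G}.
Definition induced_edge : rel {x : G | x \in A} :=
  [rel u v | edge (val u) (val v)].

Fact induced_edge_sym : symmetric induced_edge.
Proof. by move=> u v; exact: edge_sym. Qed.

Fact induced_edge_irrefl : irreflexive induced_edge.
Proof. by move=> u; exact: edge_irrefl. Qed.

Definition induced := SGraph induced_edge_sym induced_edge_irrefl.
End Induced.
End Graph.

Definition isomorphic (G H : sgraph) :=
  exists f : G -> H, bijective f /\ forall x y, edge (f x) (f y) = edge x y.

Definition path_edge n : rel 'I_n :=
  [rel i j : 'I_n | (i.+1 == j :> nat) || (j.+1 == i :> nat)].

Fact path_edge_sym n : symmetric (@path_edge n).
Proof. by move=> i j; exact: orbC. Qed.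

Fact path_edge_irrefl n : irreflexive (@path_edge n).
Proof. by move=> i; apply/negbTE; rewrite /= negb_or !gtn_eqF. Qed.

Definition path_graph n := SGraph (@path_edge_sym n) (@path_edge_irrefl n).

Definition induced_free (H G : sgraph) :=
  forall A : {set G}, ~ isomorphic (induced A) H.

Local Open Scope ring_scope.

Definition kappa (n : nat) : rat :=
  let d : rat := n%:R in
  2 * d ^+ 5 + 2 * d ^+ 4 - 3 * d ^+ 3 - d ^+ 2 + 2 * d + 4
  + (6 * d ^+ 2 - 6 * d + 4) / (d - 1) ^+ 3.

(* Main.v *)
(* Write d = t - 3, and suppose that the sets of clique number less than w are
   M-colourable.  As in Gyarfas' argument, grow an induced path
   v_1, v_2, ... whose last vertex v_m is attached to a connected set C while
   the earlier ones are far from C; each step removes N(v_m) from C and costs M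
   colours.  A path with d + 3 vertices is reached when C is not
   ((d + 2 - m) M)-colourable, which only gives the ratio d + 1.

   One factor M is saved by keeping a set A of neighbours of v_1, far from
   v_2, ..., v_m, that needs many colours: any element of A would prolong the
   path beyond v_1.  A vertex of N(v_m) in C that is adjacent to almost all of A
   is bad; since A needs many colours, the bad vertices have small clique number
   and are given a few new colours.  A component of the rest of C that touches
   only bad vertices can reuse the colours of N(v_m); otherwise a good vertex
   prolongs the path and A stays large.  For m = d, let D be a component touching
   a good vertex w.  As there is no induced path on d + 3 vertices, D is complete
   to w, and each a in A nonadjacent to w is complete to D (else a can be put
   before v_1 and a vertex of D after w).  As w is good, there are many such a,
   so the clique number of D is small.

   With "small" meaning about w / 2, this yields f(w) <= d f(w - 1) + g(w), where
   g(w) is roughly (d + 1)^(w / 2) (w / 2)^d; dividing by d^(w - 1) and summing over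
   w > 4 d + 1 (w > 11 if d = 2), and bounding f(w) by (d + 1)^(w - 1) for smaller
   w, stays below the constant kappa_d. *)

Require Import Defs.
From mathcomp Require Import all_boot all_order all_algebra zify ring lra.

Set Implicit Arguments.
Unset Strict Implicit.
Unset Printing Implicit Defensive.

Import Order.TTheory GRing.Theory Num.Theory.

Section Graph.
Variable G : sgraph.
Implicit Types (S T A B C D K W X : {set G}) (v w x y z : G) (p s : seq G).

(** * Colourings of vertex subsets *)

Definition list_colorable (L : G -> pred nat) S :=
  exists c : G -> nat,
    (forall x, x \in S -> L x (c x)) /\
    (forall x y, x \in S -> y \in S -> edge x y -> c x != c y).

(** The codomain ['I_n.+1] is inhabited even for [n = 0], so vertices outside [S] always have a
    value; being boolean, the predicate allows case analysis and contraposition. *)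
Definition colorable_set S n :=
  [exists c : {ffun G -> 'I_n.+1}, [forall x in S, (c x < n) &&
     [forall y in S, edge x y ==> (c x != c y)]]].

Lemma colP S n : reflect (list_colorable (fun _ i => i < n) S) (colorable_set S n).
Proof.
apply: (iffP existsP) => [[c /forall_inP cP]|[c [cn cP]]].
  exists (fun x => c x : nat); split=> [x /cP/andP[] //|x y xS yS xy].
  by have /andP[_ /forall_inP/(_ y yS)] := cP x xS; rewrite xy.
exists [ffun x => inord (c x)]; apply/forall_inP => x xS.
have cE z : z \in S -> (inord (c z) : 'I_n.+1) = c z :> nat.
  by move=> zS; rewrite inordK // ltnW // ltnS cn.
rewrite ffunE cE // cn //=; apply/forall_inP => y yS; apply/implyP => xy.
by rewrite ffunE -val_eqE /= !cE // cP.
Qed.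

Lemma col_mono m n S T : S \subset T -> m <= n -> colorable_set T m -> colorable_set S n.
Proof.
move=> /subsetP ST mn /colP[c [cn cP]]; apply/colP; exists c; split.
  by move=> x /ST/cn xm; apply: leq_trans mn.
by move=> x y /ST xT /ST yT; apply: cP.
Qed.

Lemma colU m n S T :
  colorable_set S m -> colorable_set T n -> colorable_set (S :|: T) (m + n).
Proof.
move=> /colP[c [cm cP]] /colP[e [en eP]]; apply/colP.
exists (fun x => if x \in S then c x else m + e x); split.
  move=> x; rewrite inE; case: ifPn => [xS _|xS /= xT].
    exact: leq_trans (cm _ xS) (leq_addr _ _).
  by rewrite ltn_add2l en.
move=> x y; rewrite !inE; case: ifPn => xS; case: ifPn => yS //= xT yT xy.
- exact: cP.
- by rewrite neq_ltn (leq_trans (cm _ xS)) // leq_addr.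
- by rewrite neq_ltn orbC (leq_trans (cm _ yS)) // leq_addr.
- by rewrite eqn_add2l eP.
Qed.

Lemma col_stable n S :
  0 < n -> (forall x y, x \in S -> y \in S -> ~~ edge x y) -> colorable_set S n.
Proof.
move=> n0 Sst; apply/colP; exists (fun=> 0); split=> // x y xS yS xy.
by have := Sst _ _ xS yS; rewrite xy.
Qed.

Lemma col_bigcup n K (F : G -> {set G}) :
  (forall w, w \in K -> colorable_set (F w) n) ->
  colorable_set (\bigcup_(w in K) F w) (#|K| * n).
Proof.
have [m] := ubnP #|K|; elim: m K => // m IHm K Km FK.
have [->|[w wK]] := set_0Vmem K.
  by rewrite big_set0; apply/colP; exists (fun=> 0); split=> x; rewrite inE.
rewrite (bigD1 w) //= (cardsD1 w) wK mulSn; apply: colU; first exact: FK.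
have -> : \bigcup_(i in K | i != w) F i = \bigcup_(i in K :\ w) F i.
  by apply: eq_bigl => i; rewrite !inE andbC.
apply: IHm => [|i]; last by rewrite inE => /andP[_ /FK].
by move: Km; rewrite (cardsD1 w K) wK.
Qed.

(** * Connected sets *)

Definition closed_in X S :=
  forall x y, x \in X -> y \in S -> edge x y -> y \in X.

Definition conn C :=
  C != set0 /\
  forall X, X \subset C -> X != set0 -> closed_in X C -> X = C.

(** A minimal nonempty closed subset of [S] is connected, and by symmetry no edge joins it to the
    rest of [S]. It is peeled off, and induction on the cardinality colours the remainder. *)
Lemma list_colorable_comp L S :
  (forall D, D \subset S -> conn D -> closed_in D S -> list_colorable L D) ->
  list_colorable L S.
Proof.
have [n] := ubnP #|S|; elim: n S => // n IHn S Sn LS.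
have [S0|Sn0] := eqVneq S set0.
  by exists (fun=> 0); split=> x; rewrite S0 inE.
pose P X := [&& X \subset S, X != set0 &
  [forall x in X, forall y in S, edge x y ==> (y \in X)]].
have PP X : reflect [/\ X \subset S, X != set0 & closed_in X S] (P X).
  apply: (iffP and3P) => -[XS X0 Xc]; split=> //.
    move=> x y xX yS xy.
    by move/forall_inP/(_ x xX)/forall_inP/(_ y yS)/implyP: Xc; apply.
  apply/forall_inP => x xX; apply/forall_inP => y yS; apply/implyP.
  exact: Xc.
have PS : P S by apply/PP; split.
have [X /minsetP[/PP[XS X0 Xc] Xmin] _] := minset_exists PS.
have Xconn : conn X.
  split=> // Y YX Y0 Yc; apply: Xmin => //; apply/PP; split=> //.
    exact: subset_trans XS.
  move=> x y xY yS xy; apply: (Yc x) => //; apply: (Xc x) => //.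
  exact: (subsetP YX).
have [c [cL cP]] := LS X XS Xconn Xc.
have symc x y : x \in S -> y \in X -> edge x y -> x \in X.
  by move=> xS yX xy; apply: (Xc y) => //; rewrite edge_sym.
have [] := IHn (S :\: X).
- have := cardsID X S; rewrite (setIidPr XS).
  have : 0 < #|X| by rewrite card_gt0.
  by move: Sn; rewrite ltnS; lia.
- move=> D DS Dconn Dc; apply: LS => //.
    exact: subset_trans DS (subsetDl _ _).
  move=> x y xD yS xy; apply: (Dc x) => //; rewrite inE yS andbT.
  have := subsetP DS _ xD; rewrite inE => /andP[xX xS].
  by apply: contra xX => yX; apply: symc xy.
move=> e [eL eP]; exists (fun x => if x \in X then c x else e x); split.
  by move=> x xS; case: ifPn => xX; [exact: cL | apply: eL; rewrite inE xX].
move=> x y xS yS xy; case: ifPn => xX; case: ifPn => yX.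
- exact: cP.
- by move: yX; rewrite (Xc x).
- by move: xX; rewrite (symc _ _ xS yX).
- by apply: eP; rewrite ?inE ?xX ?yX.
Qed.

Lemma col_comp n S :
  (forall D, D \subset S -> conn D -> closed_in D S -> colorable_set D n) ->
  colorable_set S n.
Proof.
move=> H; apply/colP; apply: list_colorable_comp => D DS Dc Dcl.
exact/colP/H.
Qed.

Lemma col_layer m n B C :
  colorable_set B m ->
  (forall D, D \subset C :\: B -> conn D -> closed_in D (C :\: B) -> colorable_set D n) ->
  colorable_set C (m + n).
Proof.
move=> Bm /col_comp CB; apply: (col_mono _ (leqnn _) (colU Bm CB)).
by apply/subsetP => x xC; rewrite !inE xC andbT orbN.
Qed.

(* The components of C outside B that do not touch B may reuse its colours. *)
Lemma col_reuse m n B C :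
  B \subset C -> colorable_set B m ->
  (forall D, D \subset C :\: B -> conn D -> closed_in D (C :\: B) ->
     colorable_set D n \/
     (forall x y, x \in D -> y \in B -> ~~ edge x y) /\ colorable_set D (m + n)) ->
  colorable_set C (m + n).
Proof.
move=> BC /colP[c [cm cP]] HD.
(* [B] takes the colours below [m]. A vertex outside [B] gets a list without these colours exactly
   when it has a neighbour in [B], so each component can be coloured independently. *)
pose touch x := [exists y in B, edge x y].
have [|e [eL eP]] := @list_colorable_comp
    (fun x i => (i < m + n) && (touch x ==> (m <= i))) (C :\: B).
  move=> D DS Dc Dcl; case: (HD D DS Dc Dcl) => [|[noB]] /colP[e [en eP]].
    exists (fun x => m + e x); split=> [x xD|x y xD yD xy].
      by rewrite ltn_add2l en // leq_addr implybT.
    by rewrite eqn_add2l eP.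
  exists e; split=> // x xD; rewrite en //=; apply/implyP => /exists_inP[y yB].
  by rewrite (negPf (noB _ _ xD yB)).
have eB x y : x \in C -> x \notin B -> y \in B -> edge x y -> c y < e x.
  move=> xC xB yB xy; apply: leq_trans (cm _ yB) _.
  have := eL x; rewrite inE xB xC => /(_ isT)/andP[_ /implyP]; apply.
  by apply/exists_inP; exists y.
apply/colP; exists (fun x => if x \in B then c x else e x); split.
  move=> x xC; case: ifPn => xB.
    exact: leq_trans (cm _ xB) (leq_addr _ _).
  by have := eL x; rewrite inE xB xC => /(_ isT)/andP[].
move=> x y xC yC xy; case: ifPn => xB; case: ifPn => yB.
- exact: cP.
- by rewrite neq_ltn eB // edge_sym.
- by rewrite neq_ltn orbC eB.
- by apply: eP; rewrite ?inE ?xB ?yB.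
Qed.

(** Without such an edge [D] would be closed in [C], hence equal to [C], although it misses the
    nonempty set [B]. *)
Lemma conn_touch B C D :
  conn C -> B \subset C -> B != set0 -> D \subset C :\: B -> conn D ->
  closed_in D (C :\: B) -> exists b d, [/\ b \in B, d \in D & edge b d].
Proof.
move=> [_ Cc] BC B0 DC [D0 _] Dcl.
have [/existsP[b /existsP[d /and3P[]]]|no] :=
  boolP [exists b, exists d, [&& b \in B, d \in D & edge b d]].
  by exists b, d.
have /Cc DE : D \subset C by apply: subset_trans DC (subsetDl _ _).
have {DE} DE : D = C.
  apply: DE => // x y xD yC xy; apply: (Dcl x) => //; rewrite inE yC andbT.
  apply: contra no => yB; apply/existsP; exists y; apply/existsP; exists x.
  by rewrite yB xD edge_sym.
have [b bB] := set0Pn _ B0.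
have := subsetP DC b; rewrite DE (subsetP BC) // inE bB => /(_ isT).
by [].
Qed.

Definition nbr v : {set G} := [set x | edge v x].

(** Otherwise the neighbours of [v] in [D] would form a closed nonempty proper subset. *)
Lemma conn_mixed v D :
  conn D -> (exists2 x, x \in D & edge v x) -> ~~ (D \subset nbr v) ->
  exists x y, [/\ x \in D, y \in D, edge v x, ~~ edge v y & edge x y].
Proof.
move=> [_ Dc] [x0 x0D vx0] Dv.
have [/existsP[x /existsP[y /and5P[]]]|no] := boolP [exists x, exists y,
  [&& x \in D, y \in D, edge v x, ~~ edge v y & edge x y]].
  by exists x, y.
suff DE : D :&: nbr v = D by move: Dv; rewrite -{1}DE subsetIr.
apply: Dc; first exact: subsetIl.
  by apply/set0Pn; exists x0; rewrite !inE x0D.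
move=> x y; rewrite !inE => /andP[xD vx] yD xy; rewrite yD /=.
apply: contraR no => vy; apply/existsP; exists x; apply/existsP; exists y.
by rewrite xD yD vx vy.
Qed.

(** * Cliques *)

Definition omega_le S q :=
  [forall K : {set G}, clique K && (K \subset S) ==> (#|K| <= q)].

Lemma omega_leP S q :
  reflect (forall K, clique K -> K \subset S -> #|K| <= q) (omega_le S q).
Proof.
apply: (iffP forallP) => H K; first by move=> Kc KS; have := H K; rewrite Kc KS.
by apply/implyP => /andP[]; apply: H.
Qed.

Lemma cliqueP K :
  reflect (forall x y, x \in K -> y \in K -> x != y -> edge x y) (clique K).
Proof.
apply: (iffP forall_inP) => H x.
  by move=> y xK yK; move/forall_inP/(_ y yK)/implyP: (H x xK).
by move=> xK; apply/forall_inP => y yK; apply/implyP; apply: H.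
Qed.

Lemma omega_le_sub S T q : S \subset T -> omega_le T q -> omega_le S q.
Proof.
move=> ST /omega_leP H; apply/omega_leP => K Kc KS.
by apply: H => //; apply: subset_trans ST.
Qed.

Lemma clique_sub K T : T \subset K -> clique K -> clique T.
Proof.
move=> /subsetP TK /cliqueP Kc; apply/cliqueP => x y /TK xK /TK yK.
exact: Kc.
Qed.

(** A clique in [T] is disjoint from [K] by irreflexivity, and its union with [K] is a clique in
    [S]. *)
Lemma omega_le_complete S q K T :
  omega_le S q -> clique K -> K \subset S -> T \subset S ->
  (forall x y, x \in K -> y \in T -> edge x y) -> omega_le T (q - #|K|).
Proof.
move=> /omega_leP Sq /cliqueP Kc KS TS KT; apply/omega_leP => L /cliqueP Lc LT.
have dKL : [disjoint K & L].
  rewrite disjoints_subset; apply/subsetP => x xK; rewrite inE.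
  apply/negP => xL; have := KT _ _ xK (subsetP LT _ xL).
  by rewrite edge_irrefl.
have : #|K :|: L| <= q.
  apply: Sq; last by rewrite subUset KS (subset_trans LT).
  apply/cliqueP => x y; rewrite !inE => /orP[xK|xL] /orP[yK|yL] xy.
  - exact: Kc.
  - by apply: KT => //; apply: (subsetP LT).
  - by rewrite edge_sym; apply: KT => //; apply: (subsetP LT).
  - exact: Lc.
by rewrite cardsU (disjoint_setI0 dKL) cards0 subn0; lia.
Qed.

Lemma omega_le_nbr S q v T :
  omega_le S q.+1 -> v \in S -> T \subset S -> T \subset nbr v -> omega_le T q.
Proof.
move=> Sq vS TS /subsetP Tv.
have := @omega_le_complete S q.+1 [set v] T Sq; rewrite cards1 subn1 /=; apply=> //.
- by apply/cliqueP => x y /set1P-> /set1P->; rewrite eqxx.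
- by rewrite sub1set.
- by move=> x y /set1P-> /Tv; rewrite inE.
Qed.

Lemma omega_le_gt S q :
  ~~ omega_le S q -> exists K, [/\ clique K, K \subset S & #|K| = q.+1].
Proof.
case/forallPn => K; rewrite negb_imply -ltnNge => /andP[/andP[Kc KS] qK].
have /card_geqP[s [us sq sK]] := qK.
exists [set x in s]; split.
- apply: clique_sub Kc; apply/subsetP => x; rewrite inE; exact: sK.
- by apply/subsetP => x; rewrite inE => /sK; apply: (subsetP KS).
- by rewrite cardsE -sq; apply/card_uniqP.
Qed.

(* A clique K in W covers A by the non-neighbours of its elements together with
   its common neighbourhood. *)
Lemma omega_nearly_complete S q A W k a b :
  0 < k -> omega_le S q -> A \subset S -> W \subset S ->
  (forall w, w \in W -> colorable_set (A :\: nbr w) a) ->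
  (forall T, T \subset S -> omega_le T (q - k) -> colorable_set T b) ->
  ~~ colorable_set A (k * a + b) -> omega_le W k.-1.
Proof.
move=> k0 Sq AS WS HW Hb; apply: contraR => /omega_le_gt[K [Kc KW]].
rewrite prednK // => Kk.
pose R := [set x in A | [forall w in K, edge w x]].
have KR : colorable_set R b.
  apply: Hb; first by apply/subsetP => x; rewrite inE => /andP[/(subsetP AS)].
  rewrite -Kk; apply: (omega_le_complete Sq Kc).
  - exact: subset_trans KW WS.
  - by apply/subsetP => x; rewrite inE => /andP[/(subsetP AS)].
  - by move=> x y xK; rewrite inE => /andP[_ /forall_inP]; apply.
have /colU/(_ KR) : colorable_set (\bigcup_(w in K) (A :\: nbr w)) (#|K| * a).
  by apply: col_bigcup => w wK; apply: HW; apply: (subsetP KW).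
rewrite Kk; apply: col_mono => //; apply/subsetP => x xA; rewrite inE orbC.
have [//|xR] := boolP (x \in R); move: xR; rewrite inE xA /=.
case/forall_inPn => w wK wx; apply/bigcupP; exists w => //.
by rewrite !inE xA andbT.
Qed.

(** * Induced paths *)

(** Distinctness is demanded only of nonadjacent pairs; for consecutive vertices it follows from
    irreflexivity. *)
Fixpoint induced_path s : bool :=
  if s is x :: s' then
    (if s' is y :: s'' then
       edge x y && all (fun z => ~~ edge x z && (x != z)) s''
     else true) && induced_path s'
  else true.

Lemma induced_path_nth x0 s i j : induced_path s -> i < j < size s ->
  (edge (nth x0 s i) (nth x0 s j) = (i.+1 == j)) /\ nth x0 s i != nth x0 s j.
Proof.
elim: s i j => [|x s IHs] i j; first by rewrite ltn0 andbF.
case: j => // j; case: i => [|i] /=; last first.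
  by move=> /andP[_ sP] ij; have := IHs i j sP ij; rewrite eqSS.
case: s IHs => [|y s] _; first by case: j.
move=> /andP[/andP[xy /allP xs] _] js.
case: j js => [|j] js /=.
  rewrite xy; split=> //; apply: contraTneq xy => ->.
  by rewrite edge_irrefl.
have /xs/andP[/negPf-> ->] : nth x0 s j \in s by rewrite mem_nth //; lia.
by [].
Qed.

Lemma induced_free_induced_path t s :
  0 < t -> induced_free (path_graph t) G -> size s = t -> ~~ induced_path s.
Proof.
move=> t0 free st; apply/negP => sP.
case: s st sP => [|x0 s']; first by move=> t0'; rewrite -t0' in t0.
move: (x0 :: s') => s st sP {s'}.
pose f (i : 'I_t) := nth x0 s i.
have fE i j : edge (f i) (f j) = @path_edge t i j.
  rewrite /path_edge /=; have [ij|ji|ij] := ltngtP i j.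
  - have [|-> _] := @induced_path_nth x0 s i j sP; first by rewrite ij st /=.
    have -> : (j.+1 == i :> nat) = false by lia.
    by rewrite orbF.
  - have [|e _] := @induced_path_nth x0 s j i sP; first by rewrite ji st /=.
    have -> : (i.+1 == j :> nat) = false by lia.
    by rewrite edge_sym e.
  - by rewrite (val_inj ij) edge_irrefl; lia.
have f_inj : injective f.
  move=> i j ij; apply/val_inj; apply/eqP; move: ij.
  have [ij|ji|//] := ltngtP i j.
    have [|_ /eqP//] := @induced_path_nth x0 s i j sP; by rewrite ij st /=.
  have [|_ /eqP ne e] := @induced_path_nth x0 s j i sP; first by rewrite ji st /=.
  by case: ne; rewrite -/(f i) -/(f j) e.
pose A := f @: [set: 'I_t].
have fA i : f i \in A by apply: imset_f.
pose g (i : 'I_t) : {x : G | x \in A} := exist _ (f i) (fA i).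
have g_inj : injective g by move=> i j /(congr1 val) /f_inj.
have g_bij : bijective g.
  apply: inj_card_bij => //.
  by rewrite card_sig card_imset // cardsT.
have [h gK hK] := g_bij.
apply: (free A); exists h; split; first by exists g.
by move=> x y; rewrite -[in RHS](hK x) -[in RHS](hK y) /= -fE.
Qed.

Definition far p C :=
  forall x c, x \in p -> c \in C -> ~~ edge x c && (x != c).

Lemma far_sub p C D : D \subset C -> far p C -> far p D.
Proof. by move=> /subsetP DC pC x c xp /DC; apply: pC. Qed.

Lemma far_cons v p C : far p C -> C \subset ~: nbr v -> v \notin C -> far (v :: p) C.
Proof.
move=> pC /subsetP Cv vC x c; rewrite inE => /orP[/eqP->|]; last exact: pC.
move=> cC; have := Cv _ cC; rewrite !inE => -> /=.
by apply: contraNneq vC => ->.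
Qed.

Lemma induced_path_cons c v p C :
  induced_path (v :: p) -> edge v c -> far p C -> c \in C -> induced_path [:: c, v & p].
Proof.
move=> vp vc pC cC.
rewrite -[induced_path _]/((_ && _) && induced_path (v :: p)) vp andbT.
rewrite edge_sym vc; apply/allP => x xp.
by rewrite edge_sym eq_sym pC.
Qed.

(** The two given paths cover every pair of vertices except [w] and [a]. *)
Lemma induced_path_rcons_cons w v p a :
  induced_path (rcons (v :: p) a) -> induced_path [:: w, v & p] ->
  ~~ edge w a -> w != a -> induced_path (rcons [:: w, v & p] a).
Proof.
rewrite -![induced_path [:: w, _ & _]]/((_ && _) && induced_path (v :: _)).
by rewrite -/rcons all_rcons => -> /andP[/andP[-> ->] _] -> ->.
Qed.

(** Gyarfas' path argument: [M] colours are spent on the neighbours of the tip [v] in [C]. By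
    connectedness each remaining component touches one of them, which becomes the next tip. After
    [r] rounds any further neighbour of the tip would complete a forbidden path. *)
Lemma rooted_col S M r v p C :
  (forall x T, x \in S -> T \subset S -> T \subset nbr x -> colorable_set T M) ->
  (forall s, size s = size p + r.+2 -> ~~ induced_path s) ->
  induced_path (v :: p) -> v \in S -> C \subset S -> conn C -> v \notin C ->
  (exists2 c, c \in C & edge v c) -> far p C -> colorable_set C (r * M).
Proof.
move=> HM; elim: r v p C => [|r IHr] v p C free vp vS CS Cc vC [c0 c0C vc0] pC.
  have /free/negP[] : size [:: c0, v & p] = size p + 2 by rewrite /= addn2.
  exact: induced_path_cons pC _.
have BC : C :&: nbr v \subset C := subsetIl _ _.
rewrite mulSn; apply: (@col_layer _ _ (C :&: nbr v)).
  by apply: (HM v) => //; [exact: subset_trans CS | exact: subsetIr].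
move=> D DC Dc Dcl.
have B0 : C :&: nbr v != set0 by apply/set0Pn; exists c0; rewrite !inE c0C.
have [b [d [bB dD bd]]] := conn_touch Cc BC B0 DC Dc Dcl.
move: bB; rewrite !inE => /andP[bC vb].
have DC' : D \subset C by apply: subset_trans DC (subsetDl _ _).
have Dv : D \subset ~: nbr v.
  apply/subsetP => x xD; have := subsetP DC _ xD.
  by rewrite !inE => /andP[+ xC]; rewrite xC.
have vD : v \notin D by apply: contra vC; apply: (subsetP DC').
apply: (IHr b (v :: p)) => //.
- by move=> s; rewrite -[size (_ :: _)]/(size p).+1 addSnnS; apply: free.
- exact: induced_path_cons pC _.
- exact: (subsetP CS).
- exact: subset_trans CS.
- by apply/negP => /(subsetP Dv); rewrite !inE vb.
- by exists d.
- by apply: far_cons => //; apply: far_sub pC.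
Qed.

End Graph.

(** * Reducing the clique number *)

Section Step.
Variables (G : sgraph) (d om k M : nat) (S : {set G}) (f : nat -> nat).
Implicit Types (T A B C D K W X : {set G}) (v w x y z : G) (p s : seq G).
Hypothesis k0 : 0 < k.
Hypothesis f0 : forall q, 0 < f q.
Hypothesis free : forall s, size s = d + 3 -> ~~ induced_path s.
Hypothesis S_om : omega_le S om.
Hypothesis HM :
  forall x T, x \in S -> T \subset S -> T \subset nbr x -> colorable_set T M.
Hypothesis Hf : forall q T, T \subset S -> omega_le T q -> colorable_set T (f q).

(* With r vertices still to be added to the path, A needs more than threshold r.+1
   colours, and w is good if A minus N(w) needs more than threshold r. *)
Fixpoint threshold i :=
  if i is i'.+1 then k * threshold i' + f (om - k) else f (om - k.+1).

Lemma threshold_gt0 i : 0 < threshold i.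
Proof. by case: i => [|i] /=; rewrite ?f0 // ltn_addl ?f0. Qed.

(** Once its neighbours are removed, [w] is isolated and can take colour 0. *)
Lemma col_nbrD1 A w n : 0 < n ->
  colorable_set (A :\: (w |: nbr w)) n -> colorable_set (A :\: nbr w) n.
Proof.
move=> n0 /colP[c [cn cP]]; apply/colP.
exists (fun x => if x == w then 0 else c x); split.
  move=> x; rewrite !inE => /andP[wx xA]; case: (eqVneq x w) => // xw.
  by apply: cn; rewrite !inE negb_or xw wx.
move=> x y; rewrite !inE => /andP[wx xA] /andP[wy yA] xy.
case: (eqVneq x w) => xw; case: (eqVneq y w) => yw.
- by move: xy; rewrite xw yw edge_irrefl.
- by move: wy; rewrite -xw xy.
- by move: wx; rewrite edge_sym in xy; rewrite -yw xy.
- by apply: cP; rewrite // !inE negb_or ?xw ?yw ?wx ?wy.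
Qed.

(** If [D] needs more than [f k] colours, it contains a clique [K] on [k + 1] vertices. Every [a] in
    [A] outside the closed neighbourhood of [w] is complete to [K], as otherwise [x, w, v, p, a]
    with [x] in [K] is an induced path on [d + 3] vertices. This lowers the clique number of these
    [a] to [om - (k + 1)], the argument of [f] in [threshold 0]. *)
Lemma col_last v p w A D :
  (size p).+1 = d -> w \in S -> w \notin D -> D \subset S -> conn D ->
  (exists2 x, x \in D & edge w x) -> far (v :: p) D -> induced_path [:: w, v & p] -> A \subset S ->
  (forall a, a \in A -> induced_path (rcons (v :: p) a)) ->
  ~~ colorable_set (A :\: nbr w) (threshold 0) -> colorable_set D (f k).
Proof.
move=> szp wS wnD DS Dc wD pD wvp AS Ap; apply: contraR => Dk.
have Dw : D \subset nbr w.
  apply: contraT => /(conn_mixed Dc wD)[x [y [xD yD wx wy xy]]].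
  have /free/negP[] : size [:: y, x, w, v & p] = d + 3.
    by rewrite /= -szp !addnS addn0.
  apply: (@induced_path_cons _ _ _ _ (D :\: nbr w)) => //.
  - exact: induced_path_cons pD xD.
  - apply: far_cons; first by apply: far_sub pD; apply: subsetDl.
      by apply/subsetP => z; rewrite !inE => /andP[].
    by rewrite inE (negPf wnD) andbF.
  - by rewrite !inE wy.
apply: col_nbrD1; first exact: threshold_gt0.
have /omega_le_gt[K [Kc KD Kk]] : ~~ omega_le D k.
  by apply: contra Dk; apply: Hf.
apply: Hf; first by apply: subset_trans AS; apply: subsetDl.
rewrite -Kk; apply: (omega_le_complete S_om Kc).
- exact: subset_trans DS.
- by apply: subset_trans AS; apply: subsetDl.
move=> x a xK; rewrite !inE negb_or => /andP[/andP[aw wa] aA].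
have xD := subsetP KD _ xK.
apply: contraT => xa.
have /free/negP[] : size (x :: rcons [:: w, v & p] a) = d + 3.
  by rewrite /= size_rcons -szp !addnS addn0.
have xwvp : induced_path [:: x, w, v & p].
  apply: (induced_path_cons _ _ pD xD) => //.
  by have := subsetP Dw _ xD; rewrite inE.
apply: (@induced_path_rcons_cons _ x w (v :: p)) => //.
  by apply: induced_path_rcons_cons => //; [exact: Ap | rewrite eq_sym].
apply: contraNneq (wa) => <-.
by have := subsetP Dw _ xD; rewrite inE.
Qed.

(* The set W of bad neighbours of v in C gets its own f k.-1 colours; a component
   that only touches W is bounded by rooted_col and reuses the M colours of the
   good neighbours of v. *)
Lemma col_split r n v p C A :
  (size p).+1 + r = d -> induced_path (v :: p) -> v \in S -> C \subset S -> conn C ->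
  v \notin C -> (exists2 c, c \in C & edge v c) -> far p C -> A \subset S ->
  ~~ colorable_set A (threshold r.+1) -> r * M <= n ->
  (forall w D, w \in C -> edge v w -> w \notin D -> D \subset C -> conn D ->
    (exists2 x, x \in D & edge w x) -> far (v :: p) D ->
    ~~ colorable_set (A :\: nbr w) (threshold r) -> colorable_set D n) ->
  colorable_set C (f k.-1 + (M + n)).
Proof.
move=> szp vp vS CS Cc vC [c0 c0C vc0] pC AS Acol rMn Hgood.
pose B := C :&: nbr v.
pose W := [set w in B | colorable_set (A :\: nbr w) (threshold r)].
have BC : B \subset C := subsetIl _ _.
have WB : W \subset B by apply/subsetP => x; rewrite inE => /andP[].
have W_om : omega_le W k.-1.
  apply: (omega_nearly_complete k0 S_om AS _ _ _ Acol).
  - exact: subset_trans (subset_trans WB BC) CS.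
  - by move=> w; rewrite inE => /andP[].
  - by move=> T TS; apply: Hf.
have W_col : colorable_set W (f k.-1).
  by apply: Hf => //; apply: subset_trans (subset_trans WB BC) CS.
suff R_col : colorable_set (C :\: W) (M + n).
  apply: (col_mono _ (leqnn _) (colU W_col R_col)).
  by apply/subsetP => x xC; rewrite !inE xC andbT orbN.
apply: (@col_reuse _ _ _ (B :\: W)); first exact: setSD.
  apply: (HM vS); first by apply: subset_trans (subsetDl _ _) (subset_trans BC CS).
  by apply: subset_trans (subsetDl _ _) (subsetIr _ _).
have -> : (C :\: W) :\: (B :\: W) = C :\: B.
  apply/setP => x; rewrite !in_setD; case: (boolP (x \in W)) => //= xW.
  by rewrite (subsetP WB).
move=> D DC Dc Dcl.
have DC' : D \subset C by apply: subset_trans DC (subsetDl _ _).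
have nBD x : x \in B -> x \notin D.
  by move=> xB; apply/negP => /(subsetP DC); rewrite in_setD xB.
have vpD : far (v :: p) D.
  apply: far_cons; first exact: far_sub pC.
    apply/subsetP => x xD; have := subsetP DC _ xD.
    by rewrite !inE => /andP[+ xC]; rewrite xC.
  by apply: contra vC; apply: (subsetP DC').
have [/existsP[w /andP[/setDP[wB wW] /exists_inP[x xD wx]]]|no] :=
  boolP [exists w, (w \in B :\: W) && [exists x in D, edge w x]].
  left; move: (wB); rewrite !inE => /andP[wC vw].
  apply: (Hgood w) => //; [exact: nBD | by exists x |].
  by move: wW; rewrite inE wB.
right; split.
  move=> x y xD yB; apply: contra no => xy; apply/existsP; exists y.
  by rewrite yB; apply/exists_inP; exists x; rewrite // edge_sym.
have B0 : B != set0 by apply/set0Pn; exists c0; rewrite !inE c0C.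
have [b [x [bB xD bx]]] := conn_touch Cc BC B0 DC Dc Dcl.
move: (bB); rewrite !inE => /andP[bC vb].
(* The path [b, v, p] has [d - r + 1] vertices, which leaves [r + 1] rounds of the path argument at
   [M] colours each, within [M + n]. *)
apply: (@col_mono _ (r.+1 * M) _ _ D) => //; first by rewrite mulSn leq_add2l.
apply: (@rooted_col _ S M r.+1 b (v :: p)) => //.
- by move=> s ss; apply: free; rewrite ss -szp /= !addnS addn0.
- exact: induced_path_cons pC _.
- exact: (subsetP CS).
- exact: subset_trans CS.
- exact: nBD.
- by exists x.
Qed.

(* Paths are listed backwards: v is the last vertex, and the elements of A are
   adjacent to the first one only. *)
Lemma col_branch r v p C A :
  (size p).+1 + r = d -> induced_path (v :: p) -> v \in S -> C \subset S -> conn C ->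
  v \notin C -> (exists2 c, c \in C & edge v c) -> far p C -> A \subset S ->
  (forall a, a \in A -> induced_path (rcons (v :: p) a)) ->
  ~~ colorable_set A (threshold r.+1) ->
  colorable_set C (r.+1 * f k.-1 + (r.+1 * M + f k)).
Proof.
elim: r v p C A => [|r IHr] v p C A szp vp vS CS Cc vC vC' pC AS Ap Acol.
  rewrite !mul1n; apply: (col_split szp vp vS CS Cc vC vC' pC AS Acol) => //.
  move=> w D wC vw wD DC Dc wD' vpD Aw.
  apply: (@col_last v p w A D) => //.
  - by rewrite -szp addn0.
  - exact: (subsetP CS).
  - exact: subset_trans CS.
  - exact: induced_path_cons pC _.
have -> : r.+2 * f k.-1 + (r.+2 * M + f k) =
  f k.-1 + (M + (r.+1 * f k.-1 + (r.+1 * M + f k))).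
  by rewrite [r.+2 * _]mulSn [r.+2 * M]mulSn; lia.
apply: (col_split szp vp vS CS Cc vC vC' pC AS Acol).
  by rewrite addnCA leq_addr.
move=> w D wC vw wD DC Dc wD' vpD Aw.
have wvp : induced_path [:: w, v & p] by apply: induced_path_cons pC _.
(* Removing [w] together with its neighbours keeps every remaining [a] distinct from, and
   nonadjacent to, the new tip. *)
apply: (IHr w (v :: p) D (A :\: (w |: nbr w))) => //.
- by rewrite -szp /= !addSn addnS.
- exact: (subsetP CS).
- exact: subset_trans CS.
- by apply: subset_trans AS; apply: subsetDl.
- move=> a; rewrite !inE negb_or => /andP[/andP[aw wa] aA].
  by apply: induced_path_rcons_cons => //; [exact: Ap | rewrite eq_sym].
- by apply: contra Aw; apply: col_nbrD1; apply: threshold_gt0.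
Qed.

Hypothesis d0 : 0 < d.
Hypothesis M0 : 0 < M.

(** Outside the neighbourhood of [v], a component is either [{v}] or is entered from a neighbour [b]
    of [v]; the two-vertex path [b, v] then leaves [d] rounds for [rooted_col]. *)
Lemma col_first v n :
  conn S -> v \in S -> colorable_set (S :&: nbr v) n -> colorable_set S (n + d * M).
Proof.
move=> Sc vS Nn; have BS : S :&: nbr v \subset S := subsetIl _ _.
apply: (col_layer Nn) => D DS Dc Dcl.
have DS' : D \subset S by apply: subset_trans DS (subsetDl _ _).
have Dv x : x \in D -> ~~ edge v x.
  by move=> xD; have := subsetP DS _ xD; rewrite !inE => /andP[+ xS]; rewrite xS.
have [vD|vD] := boolP (v \in D).
  have D1 : [set v] = D.
    have [_] := Dc; apply; first by rewrite sub1set.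
      by apply/set0Pn; exists v; rewrite inE.
    by move=> x y /set1P-> yD; rewrite (negPf (Dv _ yD)).
  rewrite -D1; apply: col_stable; first by rewrite muln_gt0 d0.
  by move=> x y /set1P-> /set1P->; rewrite edge_irrefl.
(* The cut set includes [v], which is possible as [D] avoids it; the touching vertex cannot be [v]
   itself, since [D] contains none of its neighbours. *)
have [||||b [x [bB xD bx]]] :=
    @conn_touch G (v |: (S :&: nbr v)) S D Sc _ _ _ Dc.
- by rewrite subUset sub1set vS.
- by apply/set0Pn; exists v; rewrite setU11.
- apply/subsetP => x xD; rewrite !inE negb_or (subsetP DS') // Dv // !andbT.
  by apply: contraNneq vD => <-.
- move=> x y xD; rewrite !inE negb_or => /andP[/andP[_ yB] yS].
  by apply: Dcl => //; rewrite !inE yB.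
have vb : edge v b.
  by move: bB; rewrite !inE => /orP[/eqP bv|/andP[]//]; have := Dv _ xD; rewrite -bv bx.
have bS : b \in S by move: bB; rewrite !inE => /orP[/eqP->|/andP[]].
apply: (@rooted_col _ S M d b [:: v]) => //.
- by move=> s ss; apply: free; rewrite ss addn3.
- by rewrite /= edge_sym vb.
- by apply/negP => /Dv; rewrite vb.
- by exists x.
- move=> y z; rewrite inE => /eqP-> zD; rewrite Dv //=.
  by apply: contraNneq vD => ->.
Qed.

(** If the neighbourhood of [v] is cheap, [col_first] applies. Otherwise it serves as the expensive
    set [A] of [col_branch], and one extra colour is given to [v]. *)
Lemma col_step_conn :
  conn S -> colorable_set S (d * M + maxn (threshold d) (d * f k.-1 + f k).+1).
Proof.
move=> Sc; have [v vS] := set0Pn _ Sc.1.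
have [A_col|A_col] := boolP (colorable_set (S :&: nbr v) (threshold d)).
  apply: (col_mono _ _ (col_first Sc vS A_col)) => //.
  by rewrite addnC leq_add2l leq_maxl.
apply: (@col_mono _ (1 + (d * f k.-1 + (d * M + f k))) _ _ S) => //.
  by rewrite add1n addnCA -addnS leq_add2l leq_maxr.
apply: (@col_layer _ _ _ [set v]).
  by apply: col_stable => // x y /set1P-> /set1P->; rewrite edge_irrefl.
move=> D DS Dc Dcl.
have DS' : D \subset S by apply: subset_trans DS (subsetDl _ _).
have [||b [x [/set1P-> xD vx]]] := conn_touch Sc _ _ DS Dc Dcl.
- by rewrite sub1set.
- by apply/set0Pn; exists v; rewrite inE.
have vD : v \notin D by apply/negP => /(subsetP DS); rewrite !inE eqxx.
rewrite -(prednK d0) in A_col *.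
apply: (@col_branch d.-1 v [::] D (S :&: nbr v)) => //.
- by rewrite add1n prednK.
- by exists x.
- exact: subsetIl.
- by move=> a; rewrite !inE /= => /andP[_ ->].
Qed.

End Step.

(** * Solving the recursion *)

(** The inductive step multiplies by [d ^ d.+1] and uses [d (d + 2) <= (d + 1) ^ 2]; the base case
    is [4 ^ 3 <= 3 ^ 4]. *)
Lemma expn_succ_le d : 2 < d -> d.+1 ^ d <= d ^ d.+1.
Proof.
elim: d => // d IHd; rewrite ltnS leq_eqVlt => /orP[/eqP<- //|d2].
have dp : 0 < d ^ d.+1 by rewrite expn_gt0; lia.
rewrite -(leq_pmul2r dp) -expnMn.
apply: (@leq_trans ((d.+1 ^ 2) ^ d.+1)).
  by rewrite leq_exp2r // -mulnn; lia.
rewrite -expnM (_ : 2 * d.+1 = d + d.+2); last lia.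
by rewrite expnD mulnC leq_mul2l IHd ?orbT.
Qed.

(** For [j = 4 d] this is the fourth power of [expn_succ_le], and lowering [j] only helps. It makes
    the crude bound sufficient up to clique number [4 d + 1]. *)
Lemma expn_succ_le_quad d j : 2 < d -> j <= 4 * d -> d.+1 ^ j <= d ^ (j + 4).
Proof.
move=> d2 jd; have dp : 0 < d ^ (4 * d - j) by rewrite expn_gt0; lia.
rewrite -(leq_pmul2r dp) -expnD.
apply: (@leq_trans (d.+1 ^ (4 * d))).
  rewrite -{2}(subnKC jd) expnD leq_mul2l orbC.
  by case: (4 * d - j) => // e; rewrite leq_exp2r ?leqnSn.
rewrite (_ : j + 4 + (4 * d - j) = 4 * d.+1); last lia.
by rewrite ![4 * _]mulnC !expnM leq_exp2r // expn_succ_le.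
Qed.

(** Bernoulli's inequality [(1 - 1 / (m + 1)) ^ e >= 1 - e / (m + 1)] with denominators cleared. *)
Lemma bernoulli_pred m e : e <= m.+1 -> m.+1 ^ e * (m.+1 - e) <= m.+1 * m ^ e.
Proof.
elim: e => [|e IHe] em; first by rewrite !expn0 mul1n muln1 subn0.
have {}IHe := IHe (ltnW em).
rewrite expnSr [m ^ e.+1]expnSr mulnA.
apply: (@leq_trans (m.+1 ^ e * (m.+1 - e) * m)); last by rewrite leq_mul2r IHe orbT.
rewrite -!mulnA leq_mul2l; apply/orP; right.
have [u ->] : exists u, m = e + u by exists (m - e); lia.
have -> : (e + u).+1 - e.+1 = u by lia.
have -> : (e + u).+1 - e = u.+1 by lia.
by nia.
Qed.

Lemma expn_succ_double m e : 2 * e <= m.+1 -> m.+1 ^ e <= 2 * m ^ e.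
Proof.
move=> em; have e_m : e <= m.+1 by lia.
have := bernoulli_pred e_m; move=> H.
have : m.+1 ^ e * m.+1 <= m.+1 * (2 * m ^ e).
  apply: (@leq_trans (2 * (m.+1 ^ e * (m.+1 - e)))).
    by rewrite mulnCA leq_mul2l; lia.
  by rewrite [m.+1 * _]mulnCA leq_mul2l.
by rewrite mulnC leq_pmul2l.
Qed.

(** * Colour bounds in terms of the clique number *)

Section Bounds.
Variables (G : sgraph) (d : nat).
Hypothesis d0 : 0 < d.
Hypothesis free : forall s : seq G, size s = d + 3 -> ~~ induced_path s.

Definition chi_le q n := forall S : {set G}, omega_le S q -> colorable_set S n.

(** At [q = 0] the truncated predecessor gives 1, so that the bound is positive everywhere, as the
    reduction step requires. *)
Definition crude q := d.+1 ^ q.-1.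

Lemma crude_gt0 q : 0 < crude q.
Proof. by rewrite expn_gt0. Qed.

Lemma crude_mono q r : q <= r -> crude q <= crude r.
Proof. by move=> qr; rewrite leq_exp2l //; lia. Qed.

Lemma chi_le_nbr q M S :
  chi_le q M -> omega_le S q.+1 ->
  forall v (T : {set G}), v \in S -> T \subset S -> T \subset nbr v -> colorable_set T M.
Proof. by move=> HM Sq v T vS TS Tv; apply/HM/(omega_le_nbr Sq vS TS Tv). Qed.

(** The plain path argument: taking [n = M] in [col_first] costs a factor [d + 1] per unit of clique
    number. *)
Lemma chi_le_crude q : chi_le q (crude q).
Proof.
elim: q => [|[|q] IHq] S Sq.
- apply: col_stable => // x y xS; move/omega_leP/(_ [set x]): Sq.
  suff c : clique [set x] by move=> /(_ c); rewrite cards1 sub1set => /(_ xS).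
  by apply/cliqueP => u v /set1P-> /set1P->; rewrite eqxx.
- apply: col_stable => // x y xS yS; apply/negP => xy.
  move/omega_leP/(_ [set x; y]): Sq; rewrite cards2.
  case: (eqVneq x y) xy => [->|_ xy]; first by rewrite edge_irrefl.
  suff c : clique [set x; y] by move=> /(_ c); rewrite subUset !sub1set xS yS => /(_ isT).
  apply/cliqueP => u v; rewrite !inE => /orP[]/eqP-> /orP[]/eqP->; rewrite ?eqxx //.
  by rewrite edge_sym.
apply: col_comp => D DS Dc _; have [v vD] := set0Pn _ Dc.1.
have Dq := omega_le_sub DS Sq.
have := @col_first G d (crude q.+1) D free (chi_le_nbr IHq Dq) d0 (crude_gt0 _) v
  (crude q.+1) Dc vD.
rewrite {4}/crude /= expnS mulSn; apply.
by apply: (chi_le_nbr IHq Dq vD); [exact: subsetIl | exact: subsetIr].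
Qed.

Lemma chi_le_step q k M : 0 < k -> 0 < M -> chi_le q M ->
  chi_le q.+1 (d * M + maxn (threshold q.+1 k crude d)
                            (d * crude k.-1 + crude k).+1).
Proof.
move=> k0 M0 HM S Sq; apply: col_comp => D DS Dc _.
have Dq := omega_le_sub DS Sq.
apply: (col_step_conn k0 crude_gt0 free Dq (chi_le_nbr HM Dq)) => //.
by move=> r T _; apply: chi_le_crude.
Qed.

(** With [k = n + 1], about half of [q], both [q - k] and [q - k - 1] are at most [n]; each
    recursion step then multiplies the bound by at most [(n + 1) + 1]. *)
Lemma threshold_crude q n i : 0 < n -> q <= n.*2.+1 ->
  threshold q n.+1 crude i <= d.+1 ^ n.-1 * n.+2 ^ i.
Proof.
move=> n0 qn; have cr r : r <= n -> crude r <= d.+1 ^ n.-1 by apply: crude_mono.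
elim: i => [|i IHi] /=; first by rewrite expn0 muln1 cr //; lia.
apply: (@leq_trans (n.+1 * (d.+1 ^ n.-1 * n.+2 ^ i) + d.+1 ^ n.-1)).
  by rewrite leq_add ?cr ?leq_mul2l ?IHi ?orbT //; lia.
have : 0 < n.+2 ^ i by rewrite expn_gt0.
rewrite [n.+2 ^ i.+1]expnS; nia.
Qed.

Lemma chi_le_step_crude q n M : 2 * d < n -> q.+1 <= n.*2.+1 -> 0 < M ->
  chi_le q M -> chi_le q.+1 (d * M + d.+1 ^ n.-1 * n.+2 ^ d).
Proof.
move=> dn qn M0 HM S Sq; have n0 : 0 < n by lia.
apply: (col_mono (subxx _) _ (chi_le_step (ltn0Sn n) M0 HM Sq)).
(* The other term of the maximum is at most [(2 d + 2) (d + 1) ^ (n - 1)], and [2 d < n] makes the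
   factor smaller than [n + 2]. *)
rewrite leq_add2l geq_max threshold_crude //= /crude /=.
case: n dn n0 {qn} => // n dn _ /=.
have p0 : 0 < d.+1 ^ n by rewrite expn_gt0.
have : n.+3 <= n.+3 ^ d by rewrite -{1}[n.+3]expn1 leq_exp2l.
rewrite expnS; nia.
Qed.

(* The second summand is 9 d^(2n+2) times the next term of the error series, whose
   consecutive terms have ratio at most 8/9. *)
Lemma chi_le_odd_large i : 2 < d -> exists2 M, 0 < M &
  chi_le (2 * (2 * d + i) + 1) M /\
  d ^ 2 * M + 9 * (d.+1 ^ (2 * d + i).+1 * (2 * d + i + 3) ^ d) <=
    2 * d ^ (2 * (2 * d + i) + 7).
Proof.
move=> d2; have d3 : 3 * d ^ 2 <= d ^ 3 by rewrite [d ^ 3]expnS leq_mul2r d2 orbT.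
elim: i => [|i [M M0 [HM Mle]]].
  exists (crude (4 * d).+1); first exact: crude_gt0.
  rewrite addn0 mulnA addn1; split; first exact: chi_le_crude.
  rewrite /crude /=.
  have e1 := expn_succ_le_quad d2 (leqnn _).
  have e2 : d.+1 ^ (2 * d) <= d ^ (2 * d + 2).
    rewrite (_ : 2 * d + 2 = d.+1 * 2); last lia.
    by rewrite [2 * d]mulnC !expnM leq_exp2r // expn_succ_le.
  have e3 : (2 * d + 3) ^ d <= d ^ (2 * d).
    by rewrite expnM leq_exp2r // -mulnn; nia.
  have e4 : d ^ (4 * d + 7) = d ^ 3 * d ^ (4 * d + 4).
    by rewrite -!expnD; congr (_ ^ _); lia.
  have e5 : d ^ (4 * d + 4) = d ^ 2 * (d ^ (2 * d + 2) * d ^ (2 * d)).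
    by rewrite -!expnD; congr (_ ^ _); lia.
  have e6 := leq_mul e2 e3.
  have e7 : 9 * d.+1 <= 2 * d ^ 3 by move: d3; rewrite -mulnn; nia.
  rewrite e4 [d.+1 ^ (2 * d).+1]expnS -[d.+1 * _ * _]mulnA.
  apply: (@leq_trans (d ^ 2 * d ^ (4 * d + 4) +
                      d ^ 3 * (2 * (d ^ (2 * d + 2) * d ^ (2 * d))))).
    apply: leq_add; first by rewrite leq_mul2l e1 orbT.
    by rewrite mulnA [d ^ 3 * _]mulnCA [2 * (_ * _)]mulnA leq_mul.
  rewrite e5; move: (d ^ (2 * d + 2) * d ^ (2 * d)) => Z.
  rewrite -mulnn in d3 *; move: (d ^ 3) d3 => D3 d3; nia.
set N := 2 * d + i in HM Mle *.
have N0 : 2 * d < N.+1 by rewrite ltnS leq_addr.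
(* Two consecutive clique numbers are handled with the same [n = N + 1], hence the same error [X];
   together they contribute [(d + 1) X]. *)
pose X := d.+1 ^ N * N.+3 ^ d.
have X0 : 0 < X by rewrite muln_gt0 !expn_gt0.
have HM1 : chi_le (2 * N + 1).+1 (d * M + X).
  by apply: (@chi_le_step_crude _ N.+1) => //; lia.
have HM2 : chi_le (2 * N + 1).+2 (d * (d * M + X) + X).
  by apply: (@chi_le_step_crude _ N.+1) => //; lia.
exists (d * (d * M + X) + X); first by rewrite addn_gt0 X0 orbT.
have -> : 2 * d + i.+1 = N.+1 by rewrite addnS.
split; first by rewrite (_ : 2 * N.+1 + 1 = (2 * N + 1).+2) //; lia.
have e1 : N.+4 ^ d <= 2 * N.+3 ^ d by apply: expn_succ_double; lia.
(* The ratio [2 (d + 1) / d ^ 2] is at most 8/9, with equality at [d = 3]; the factor 9 is the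
   geometric sum [1 / (1 - 8/9)]. *)
have e2 : 9 * d.+1 * 2 <= 8 * d ^ 2 by rewrite -mulnn; nia.
have e3 : d ^ (2 * N.+1 + 7) = d ^ 2 * d ^ (2 * N + 7).
  by rewrite -!expnD; congr (_ ^ _); lia.
have p1 : d.+1 ^ N.+1 = d.+1 * d.+1 ^ N by rewrite expnS.
have p2 : d.+1 ^ N.+2 = d.+1 * (d.+1 * d.+1 ^ N) by rewrite !expnS.
rewrite e3 p2 /X !addn3; rewrite p1 addn3 in Mle.
move: (d.+1 ^ N) (N.+3 ^ d) (N.+4 ^ d) (d ^ (2 * N + 7)) e1 Mle.
move=> P Q R T e1 Mle; rewrite -mulnn in e2 Mle *.
have {}e1 : 9 * (d.+1 * (d.+1 * P) * R) <= 8 * (d * d) * (d.+1 * P * Q).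
  apply: (@leq_trans (9 * d.+1 * 2 * (d.+1 * P * Q))); last by rewrite leq_mul2r e2 orbT.
  by have := leq_mul (leqnn (9 * d.+1 * (d.+1 * P))) e1; nia.
have := leq_mul (leqnn (d * d)) Mle; nia.
Qed.

Lemma chi_le_large q : 2 < d -> 0 < q -> chi_le q (2 * d ^ (q + 4)).
Proof.
move=> d2 q0 S Sq; have [q_le|q_gt] := leqP q (4 * d).+1.
  apply: col_mono (chi_le_crude Sq) => //.
  apply: (leq_trans (expn_succ_le_quad d2 _)); first lia.
  by apply: (@leq_trans (d ^ (q + 4))); [rewrite leq_exp2l; lia | lia].
have [i qE] : exists i, q = 2 * (2 * d + i) + 1 \/ q = (2 * (2 * d + i) + 1).+1.
  by exists (q.-1 %/ 2 - 2 * d); lia.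
have [M M0 [HM Mle]] := chi_le_odd_large i d2.
set N := 2 * d + i in qE HM Mle.
have d20 : 0 < d ^ 2 by rewrite expn_gt0; lia.
case: qE => qE; subst q.
  apply: col_mono (HM S Sq) => //; rewrite -(leq_pmul2l d20).
  rewrite mulnCA -expnD (_ : 2 + (2 * N + 1 + 4) = 2 * N + 7); last lia.
  by apply: leq_trans Mle; apply: leq_addr.
(* An even [q] takes one more step from the odd bound; its error fits into the reserved second
   summand. *)
have := @chi_le_step_crude (2 * N + 1) N.+1 M _ _ M0 HM S Sq.
move=> /(_ _ _)/(col_mono (subxx _)); apply; [|lia|lia].
rewrite -(leq_pmul2l (ltnW (ltnW d2))) [d * (2 * _)]mulnCA -expnS.
rewrite (_ : ((2 * N + 1).+1 + 4).+1 = 2 * N + 7); last lia.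
apply: leq_trans Mle; rewrite mulnDr mulnA mulnn leq_add2l addn3.
rewrite [d.+1 ^ N.+1]expnS !mulnA leq_mul2r leq_mul2r; lia.
Qed.

(** Here [threshold] at 2 equals [3 ^ m * (k ^ 2 + 3 * k + 3)] exactly. The conditions on [k] make
    it dominate the other term of the maximum, which is at most [46 * 3 ^ m]. *)
Lemma chi_le_step_two q k m M : d = 2 -> 7 <= k -> 0 < M -> q.+1 = k + m.+2 ->
  3 ^ k <= 3 ^ m * 81 -> chi_le q M ->
  chi_le q.+1 (2 * M + 3 ^ m * (k ^ 2 + 3 * k + 3)).
Proof.
move=> d2 k7 M0 qE km HM S Sq; have k0 : 0 < k by lia.
apply: (col_mono (subxx _) _ (chi_le_step k0 M0 HM Sq)).
rewrite d2 leq_add2l geq_max /= /crude d2 qE.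
have -> : (k + m.+2 - k.+1).-1 = m by lia.
have -> : (k + m.+2 - k).-1 = m.+1 by lia.
case: k k0 k7 km {qE} => // [[|k]] // _ k7.
rewrite -mulnn /= !expnS; have : 0 < 3 ^ m by rewrite expn_gt0.
by move: (3 ^ m) (3 ^ k) => P Q P0 PQ; apply/andP; split; nia.
Qed.

(* For d = 2 the ratio of consecutive terms of the error series only tends to 3/4;
   the quadratic factor makes the second summand telescope exactly. *)
Lemma chi_le_odd_two i : d = 2 -> exists2 M, 0 < M &
  chi_le (2 * (i + 5) + 1) M /\
  9 * M + 5 * ((i + 5) ^ 2 + 13 * (i + 5) + 55) * 3 ^ (i + 5) <=
    828 * 4 ^ (i + 5).
Proof.
move=> d2; elim: i => [|i [M M0 [HM Mle]]].
  (* The invariant implies [M <= 92 * 2 ^ (q - 1)] at [q = 2 (i + 5) + 1], because [828 = 9 * 92].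
     It starts from the crude value [3 ^ 10]. *)
  exists (crude 11); first exact: crude_gt0.
  split; first exact: chi_le_crude.
  have -> : crude 11 = 3 ^ 5 * 3 ^ 5 by rewrite /crude d2 -expnD.
  have -> : 3 ^ (0 + 5) = 243 by [].
  have -> : 4 ^ (0 + 5) = 1024 by [].
  by have -> : (0 + 5) ^ 2 = 25 by []; lia.
pose X := 3 ^ (i + 3) * ((i + 7) ^ 2 + 3 * (i + 7) + 3).
(* Both steps use [k = i + 7], with [m = i + 3] and then [m = i + 4], so the second error is
   [3 * X]. *)
have HM1 : chi_le (2 * (i + 5) + 1).+1 (2 * M + X).
  apply: chi_le_step_two => //; try lia.
  by rewrite -[81]/(3 ^ 4) -expnD leq_exp2l //; lia.
have HM2 : chi_le (2 * (i + 5) + 1).+2 (2 * (2 * M + X) + 3 * X).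
  rewrite /X mulnA -expnS; apply: chi_le_step_two => //; try lia.
  by rewrite -[81]/(3 ^ 4) -expnD leq_exp2l //; lia.
exists (2 * (2 * M + X) + 3 * X); first by lia.
split; first by rewrite (_ : 2 * (i.+1 + 5) + 1 = (2 * (i + 5) + 1).+2) //; lia.
have p1 : 3 ^ (i.+1 + 5) = 27 * 3 ^ (i + 3).
  by rewrite -[27]/(3 ^ 3) -expnD; congr (_ ^ _); lia.
have p2 : 3 ^ (i + 5) = 9 * 3 ^ (i + 3).
  by rewrite -[9]/(3 ^ 2) -expnD; congr (_ ^ _); lia.
have p3 : 4 ^ (i.+1 + 5) = 4 * 4 ^ (i + 5) by rewrite -expnS.
rewrite p1 p3 /X; rewrite p2 in Mle; move: (3 ^ (i + 3)) (4 ^ (i + 5)) Mle => P T.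
by rewrite -!mulnn; nia.
Qed.

Lemma chi_le_two q : d = 2 -> 0 < q -> chi_le q (92 * 2 ^ q.-1).
Proof.
move=> d2 q0 S Sq; have [q_le|q_gt] := leqP q 11.
  apply: col_mono (chi_le_crude Sq) => //; rewrite /crude d2.
  have: q.-1 <= 10 by lia.
  move: q.-1 => j {q q0 Sq q_le} j10.
  (* Scaling by [2 ^ (10 - j)] reduces to [j = 10], where [3 ^ 10 <= 92 * 2 ^ 10]. *)
  rewrite -(leq_pmul2r (_ : 0 < 2 ^ (10 - j))) ?expn_gt0 //.
  rewrite -mulnA -expnD subnKC //.
  apply: (@leq_trans (3 ^ 10)).
    rewrite -{2}(subnKC j10) expnD leq_mul2l; apply/orP; right.
    by case: (10 - j) => // e; rewrite leq_exp2r.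
  rewrite -[10]/(5 + 5) !expnD.
  have -> : 3 ^ 5 = 243 by [].
  by have -> : 2 ^ 5 = 32 by []; lia.
have [i qE] : exists i, q = 2 * (i + 5) + 1 \/ q = (2 * (i + 5) + 1).+1.
  by exists (q.-1 %/ 2 - 5); lia.
have [M M0 [HM Mle]] := chi_le_odd_two i d2.
have p4 : 4 ^ (i + 5) = 2 ^ (2 * (i + 5)) by rewrite expnM.
case: qE => qE; subst q.
  apply: col_mono (HM S Sq) => //.
  by rewrite addn1 succnK -p4; lia.
have HM1 : chi_le (2 * (i + 5) + 1).+1
    (2 * M + 3 ^ (i + 3) * ((i + 7) ^ 2 + 3 * (i + 7) + 3)).
  apply: chi_le_step_two => //; try lia.
  by rewrite -[81]/(3 ^ 4) -expnD leq_exp2l //; lia.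
apply: col_mono (HM1 S Sq) => //.
rewrite addn1 succnK [2 ^ _.+1]expnS -p4.
have p2 : 3 ^ (i + 5) = 9 * 3 ^ (i + 3).
  by rewrite -[9]/(3 ^ 2) -expnD; congr (_ ^ _); lia.
rewrite p2 in Mle; move: (3 ^ (i + 3)) (4 ^ (i + 5)) Mle => P T.
by rewrite -!mulnn; nia.
Qed.

End Bounds.

(** * Whole graphs and the constant [kappa] *)

Lemma chromatic_number_le (G : sgraph) n :
  colorable_set [set: G] n -> chromatic_number G <= n.
Proof.
move=> /colP[c [cn cP]]; rewrite /chromatic_number; case: ex_minnP => m _; apply.
have {}cn x : c x < n by apply: cn; rewrite inE.
apply/existsP; exists [ffun x => Ordinal (cn x)].
apply/forallP => x; apply/forallP => y; apply/implyP => xy.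
by rewrite !ffunE -val_eqE /= cP ?inE.
Qed.

Lemma omega_le_clique_number (G : sgraph) : omega_le [set: G] (clique_number G).
Proof.
apply/omega_leP => K Kc _; rewrite /clique_number.
exact: (@leq_bigmax_cond _ _ (fun A : {set G} => #|A|) K Kc).
Qed.

Lemma chromatic_number0 (G : sgraph) :
  clique_number G = 0 -> chromatic_number G = 0.
Proof.
move=> G0; apply/eqP; rewrite -leqn0; apply: chromatic_number_le.
have noG (x : G) : False.
  have /omega_leP/(_ [set x]) := omega_le_clique_number G; rewrite G0 cards1 subsetT.
  suff c : clique [set x] by move=> /(_ c isT).
  by apply/cliqueP => u v /set1P-> /set1P->; rewrite eqxx.
by apply/colP; exists (fun=> 0); split=> x; case: (noG x).
Qed.

Local Open Scope ring_scope.

(** Substituting [x = y + 2], and clearing the denominator for the upper bound, leaves only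
    nonnegative coefficients in [y]. *)
Lemma kappa_bounds (R : realFieldType) (x : R) : 2 <= x ->
  2 * x ^+ 5 <=
  2 * x ^+ 5 + 2 * x ^+ 4 - 3 * x ^+ 3 - x ^+ 2 + 2 * x + 4
    + (6 * x ^+ 2 - 6 * x + 4) / (x - 1) ^+ 3 <= 3 * x ^+ 5.
Proof.
move=> x2; have [y [y0 ->]] : exists y, 0 <= y /\ x = y + 2.
  by exists (x - 2); rewrite subr_ge0 subrK.
have -> : y + 2 - 1 = y + 1 by ring.
have p i : 0 <= y ^+ i by apply: exprn_ge0.
have cp n i : 0 <= n%:R * y ^+ i by rewrite mulr_ge0 ?ler0n.
have y1 : 0 < (y + 1) ^+ 3 by rewrite exprn_gt0 // ltr_wpDl.
apply/andP; split.
  rewrite -subr_ge0; set z := (y + 1) ^+ 3 in y1 *.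
  rewrite [X in 0 <= X](_ : _ = 2 * y ^+ 4 + 13 * y ^+ 3 + 29 * y ^+ 2 +
    26 * y ^+ 1 + 12 * y ^+ 0 + (6 * y ^+ 2 + 18 * y ^+ 1 + 16 * y ^+ 0) / z);
    last by ring.
  by rewrite !(addr_ge0, cp) // divr_ge0 ?(ltW y1) // !addr_ge0.
rewrite -lerBrDl ler_pdivrMr // -subr_ge0.
rewrite [X in 0 <= X](_ : _ = y ^+ 8 + 11 * y ^+ 7 + 54 * y ^+ 6 +
  157 * y ^+ 5 + 296 * y ^+ 4 + 362 * y ^+ 3 + 267 * y ^+ 2 + 96 * y ^+ 1 +
  4 * y ^+ 0); last by ring.
by rewrite !(addr_ge0, cp).
Qed.

Lemma kappa_le d : (1 < d)%N -> kappa d <= 3 * (d%:R : rat) ^+ 5.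
Proof.
by move=> d1; have /kappa_bounds/andP[] : 2 <= d%:R :> rat by rewrite ler_nat.
Qed.

Lemma kappa_ge d : (1 < d)%N -> 2 * (d%:R : rat) ^+ 5 <= kappa d.
Proof.
by move=> d1; have /kappa_bounds/andP[] : 2 <= d%:R :> rat by rewrite ler_nat.
Qed.

Lemma kappa2 : kappa 2 = 92.
Proof. by rewrite /kappa; field. Qed.

(** For [d > 2] the bound [2 d ^ 5 <= kappa d] suffices. For [d = 2] it gives only 64, so the exact
    value 92 is used. *)
Lemma chromatic_number_kappa (G : sgraph) d :
  (1 < d)%N -> (forall s : seq G, size s = (d + 3)%N -> ~~ induced_path s) ->
  (0 < clique_number G)%N ->
  (chromatic_number G)%:R <= kappa d * (d%:R : rat) ^+ (clique_number G).-1.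
Proof.
move=> d1 free q0; have G_om := omega_le_clique_number G.
have [d2|d2|d2] := ltngtP d 2; first by lia.
  have := chromatic_number_le (chi_le_large (ltnW d1) free d2 q0 G_om).
  rewrite -(ler_nat rat) => /le_trans; apply.
  apply: (@le_trans _ _ (2 * d%:R ^+ 5 * d%:R ^+ (clique_number G).-1)).
    rewrite -mulrA -exprD (_ : 5 + _ = clique_number G + 4)%N; last lia.
    by rewrite natrM natrX.
  by rewrite ler_wpM2r ?exprn_ge0 // kappa_ge.
have := chromatic_number_le (chi_le_two (ltnW d1) free d2 q0 G_om).
by rewrite -(ler_nat rat) natrM natrX d2 kappa2.
Qed.

Theorem theorem1 (t d : nat) (ht : (5 <= t)%N) (hd : d = (t - 3)%N) :
  kappa d <= 3 * (d%:R : rat) ^+ 5 /\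
  (forall G : sgraph, induced_free (path_graph t) G ->
     (chromatic_number G)%:R
       <= kappa d * (d%:R : rat) ^ ((clique_number G)%:Z - 1) /\
     (chromatic_number G <= 3 * (t - 3) ^ (clique_number G + 4))%N).
Proof.
have d1 : (1 < d)%N by lia.
have kd := kappa_le d1; split=> // G Gfree; rewrite -hd.
(* For the empty graph the integer exponent is [-1]; the chromatic number is 0 and the right-hand
   side is nonnegative. *)
have [q0|q0] := posnP (clique_number G).
  rewrite (chromatic_number0 q0) leq0n mulr_ge0 ?exprz_ge0 ?ler0n //.
  by apply: le_trans (kappa_ge d1); rewrite mulr_ge0 ?exprn_ge0.
have free (s : seq G) : size s = (d + 3)%N -> ~~ induced_path s.
  by move=> ss; apply: (induced_free_induced_path _ Gfree); lia.
have := chromatic_number_kappa d1 free q0.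
rewrite -{1 2 3}(prednK q0) intS addrC addKr -exprnP => chiG; split=> //.
rewrite -(ler_nat rat); apply: le_trans chiG _.
rewrite natrM natrX addSn -addnS addnC exprD mulrA ler_wpM2r ?exprn_ge0 //.
Qed.
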